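(* Let $T_n$ denote the random tree on $n$ vertices generated by the Barabási–Albert preferential attachment model with $m_0=m=1$ (linear preferential attachment). Then $$\lim_{n\to\infty}\mathbb{P}\big(\mathcal{E}(T_n) < n\big)=1,$$ i.e. with probability tending to $1$ as $n\to\infty$, $T_n$ is hypoenergetic.
   Context: For a finite simple graph $G$ with adjacency matrix $A(G)$ having eigenvalues $\lambda_1,\dots,\lambda_n$, the energy of $G$ is $\mathcal{E}(G)=\sum_{i=1}^n|\lambda_i|$. A graph on $n$ vertices is called hypoenergetic if $\mathcal{E}(G)<n$. The Barabási–Albert tree is built as follows: start with a single vertex (the second vertex is joined to it); thereafter, at each step a new vertex is added together with exactly one edge joining it to an already existing vertex $i$, chosen with probability $d_i/\sum_j d_j$, where $d_j$ is the current degree of vertex $j$. After $n$ vertices have been added, the resulting random tree is $T_n$. *)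

(* Defs.v *)
From HB Require Import structures.
From mathcomp Require Import all_boot all_order all_algebra all_field.
From mathcomp Require Import all_classical all_reals all_analysis.
Set Implicit Arguments. Unset Strict Implicit. Unset Printing Implicit Defensive.
Import Order.TTheory GRing.Theory Num.Theory.
Local Open Scope ring_scope.

(* Eigenvalues (with algebraic multiplicity) of a square complex-algebraic
   matrix: the roots of its (monic) characteristic polynomial. *)
Definition spectrum (n : nat) (A : 'M[algC]_n) : seq algC :=
  sval (closed_field_poly_normal (char_poly A)).

Definition mx_energy (n : nat) (A : 'M[algC]_n) : algC :=
  \sum_(z <- spectrum A) `|z|.

(* A tree on vertices 0..n-1 built by sequential attachment is encoded by
   its parent function par : vertex k >= 1 is attached to par k < k
   (par 0 = 0 by convention). *)

Definition parent_fun (n : nat) := {ffun 'I_n -> 'I_n}.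

Definition valid_parent (n : nat) (par : parent_fun n) : bool :=
  [forall k : 'I_n, if val k == 0%N then val (par k) == 0%N
                    else (val (par k) < val k)%N].

Definition tree_adj (n : nat) (par : parent_fun n) : 'M[algC]_n :=
  \matrix_(i, j) (if ((val j < val i)%N && (par i == j))
                     || ((val i < val j)%N && (par j == i)) then 1 else 0).

(* Degree of vertex i in the tree spanned by the first k vertices 0..k-1
   (for i < k): its children among 1..k-1, plus the edge to its parent
   when i >= 1. *)
Definition deg_before (n : nat) (par : parent_fun n) (k : nat) (i : 'I_n)
  : nat :=
  (#|[set j : 'I_n | (0 < val j < k)%N && (par j == i)]| + (0 < val i)%N)%N.

(* Probability that vertex k (k >= 1) attaches to par k:
   for k = 1 it attaches to vertex 0 with probability 1; for k >= 2 it
   attaches to i with probability d_i / sum_j d_j = d_i / (2 (k-1)). *)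
Definition attach_prob (n : nat) (par : parent_fun n) (k : 'I_n) : rat :=
  if val k == 1%N then 1
  else (deg_before par (val k) (par k))%:R / (2 * (val k).-1)%:R.

Definition BA_prob (n : nat) (par : parent_fun n) : rat :=
  if valid_parent par then \prod_(k : 'I_n | (0 < val k)%N) attach_prob par k
  else 0.

Definition hypoenergetic_tree (n : nat) (par : parent_fun n) : bool :=
  mx_energy (tree_adj par) < n%:R.

Definition prob_hypo (n : nat) : rat :=
  \sum_(par : parent_fun n | hypoenergetic_tree par) BA_prob par.

(* Main.v *)
Require Import Defs.
From HB Require Import structures.
From mathcomp Require Import all_boot all_order all_algebra all_field.
From mathcomp Require Import all_classical all_reals all_analysis.
From mathcomp Require Import spectral sesquilinear.
From mathcomp Require Import ring lra zify.
Import Order.TTheory GRing.Theory Num.Theory.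
Import numFieldNormedType.Exports.
Local Open Scope classical_set_scope.
Local Open Scope sesquilinear_scope.
Local Open Scope ring_scope.

(** Write [E(A) = tr (A S)] with [S] unitary. Weighting the entries of [S] by
AM-GM gives, for nonnegative vertex weights [y] that are not both zero on an
edge, [E(T) <= sum_v y_v + sum_(uv) 1 / (y_u + y_v)]. Take [y_v] depending
only on the number [c] of children of [v], with [y_v] close to [sqrt c] and
[y_v = 0] at the leaves. Bounding every edge by [1 / y_parent] decomposes [T]
into the stars formed by a vertex and its children and costs [2 sqrt c] per
star: in the limit degree distribution [4 / ((c+1)(c+2)(c+3))] this is about
[1.006 n], slightly too much. If a vertex has a single child and that child is
not a leaf, however, their edge costs at most [1/2] instead of [1], and there
are about [n/6 - 2n/15 = n/30] such vertices, which brings the bound below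
[0.997 n]. The counts involved have an affine drift and bounded increments, so
their variance is [O(n)] and Chebyshev's inequality applies. *)

(** * Energy of a normal matrix and weighted bounds for it *)

Lemma char_poly_similar (F : fieldType) (n : nat) (P D : 'M[F]_n) :
  P \in unitmx -> char_poly (invmx P *m D *m P) = char_poly D.
Proof.
move=> uP; pose Q := map_mx (@polyC F) P; pose Q' := map_mx (@polyC F) (invmx P).
have QK : Q' *m Q = 1%:M by rewrite -map_mxM mulVmx // map_mx1.
rewrite /char_poly.
have -> : char_poly_mx (invmx P *m D *m P) = Q' *m char_poly_mx D *m Q.
  rewrite /char_poly_mx !map_mxM /= mulmxBr mulmxBl; congr (_ - _).
  by rewrite scalar_mxC -mulmxA QK mulmx1.
by rewrite !det_mulmx mulrAC -det_mulmx QK det1 mul1r.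
Qed.

(** The roots in [spectrum] come in an unspecified order, hence [perm_eq]: both lists split the same
    characteristic polynomial into linear factors. *)
Lemma spectrum_normal {n : nat} (A : 'M[algC]_n) : A \is normalmx ->
  perm_eq (spectrum A) [seq spectral_diag A 0 i | i <- enum 'I_n].
Proof.
move=> nA; apply: prod_XsubC_eq.
rewrite /spectrum; case: closed_field_poly_normal => /= r.
rewrite (monicP (char_poly_monic A)) scale1r => <-.
rewrite {1}(orthomx_spectralP nA) char_poly_similar ?spectral_unit //.
rewrite char_poly_trig; last by apply: diag_mx_is_trig.
rewrite big_map big_enum /=; apply: eq_bigr => i _.
by rewrite mxE eqxx mulr1n.
Qed.

Lemma unitarymx_row_sum {n : nat} (S : 'M[algC]_n) i : S \is unitarymx ->
  \sum_j `|S i j| ^+ 2 = 1.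
Proof.
move=> /unitarymxP /matrixP /(_ i i); rewrite !mxE eqxx mulr1n => <-.
by apply: eq_bigr => j _; rewrite !mxE normCK.
Qed.

Lemma mx_energy_trace {n : nat} (A : 'M[algC]_n) : A \is normalmx ->
  exists2 S : 'M[algC]_n, S \is unitarymx & mx_energy A = \tr (A *m S).
Proof.
move=> nA; set P := spectralmx A; set d := spectral_diag A.
(* The inverse phase of each eigenvalue; the value 1 at a zero eigenvalue keeps [diag_mx u]
   unitary. *)
pose u : 'rV[algC]_n := \row_i (if d 0 i == 0 then 1 else `|d 0 i| / d 0 i).
have Pu : P \is unitarymx by apply: spectral_unitarymx.
have du i : d 0 i * u 0 i = `|d 0 i|.
  by rewrite mxE; case: eqP => [->|/eqP h]; rewrite ?mul0r ?normr0 // mulrC divfK.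
have nu i : u 0 i * (u 0 i)^* = 1.
  rewrite -normCK mxE; case: eqP => [|/eqP h]; first by rewrite normr1 expr1n.
  by rewrite normrM normfV normr_id divff ?normr_eq0 // expr1n.
have Du : diag_mx u \is unitarymx.
  apply/unitarymxP; rewrite tr_diag_mx map_diag_mx mulmx_diag.
  apply/matrixP => i j; rewrite mxE [RHS]mxE; case: eqP => // ->; rewrite !mulr1n.
  by rewrite mxE [X in _ * X]mxE nu.
exists (P ^t* *m diag_mx u *m P).
  by rewrite !mul_unitarymx // trmxC_unitary.
rewrite /mx_energy (perm_big _ (spectrum_normal _ nA)) /= big_map big_enum /=.
rewrite {2}(orthomx_spectralP nA) -/P -/d invmx_unitary // !mulmxA.
rewrite -(mulmxA _ P) (unitarymxP Pu) mulmx1 mxtrace_mulC !mulmxA.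
rewrite (unitarymxP Pu) mul1mx mulmx_diag mxtrace_diag.
by apply: eq_bigr => i _; rewrite [RHS]mxE du.
Qed.

(* The weighted AM-GM inequality [2 s <= w s^2 + 1 / w] with [w = y i + y j],
   applied to the entries of a unitary [S] such that [mx_energy A = tr (A S)]:
   the terms [y i s^2] add up to [y i] along rows and columns. *)
Lemma mx_energy_le {n : nat} (A : 'M[algC]_n) (y : 'I_n -> algC) :
  A \is normalmx -> (forall i j, `|A i j| <= 1) -> (forall i, 0 <= y i) ->
  (forall i j, A i j != 0 -> 0 < y i + y j) ->
  mx_energy A <= \sum_i y i + 2^-1 * \sum_i \sum_j `|A i j| / (y i + y j).
Proof.
move=> nA A1 y0 yA; have [S uS ES] := mx_energy_trace _ nA.
have r0 : 0 <= mx_energy A by apply: sumr_ge0 => *; apply: normr_ge0.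
have -> : mx_energy A = `|mx_energy A| by rewrite ger0_norm.
have ent i j : `|A i j| * `|S j i| <=
    2^-1 * (y i * `|S j i| ^+ 2) + 2^-1 * (y j * `|S j i| ^+ 2)
    + 2^-1 * (`|A i j| / (y i + y j)).
  (* A zero entry is treated apart, since then [y i + y j] may vanish. *)
  have [->|Anz] := eqVneq (A i j) 0.
    rewrite normr0 !mul0r mulr0 addr0 -mulrDr -mulrDl.
    by rewrite mulr_ge0 ?invr_ge0 ?ler0n // mulr_ge0 ?addr_ge0 ?exprn_ge0.
  have w0 := yA _ _ Anz; set w := y i + y j in w0 *.
  rewrite -!mulrDr -mulrDl -/w ler_pdivlMl ?ltr0n //.
  set s := `|S j i|; have s0 : 0 <= s by apply: normr_ge0.
  (* AM-GM is scaled by [|A i j|]; the bound [|A i j| <= 1] then drops this factor from the term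
     [w * s ^+ 2]. *)
  apply: (@le_trans _ _ (`|A i j| * (w * s ^+ 2 + w^-1))).
    rewrite mulrCA ler_wpM2l // -subr_ge0.
    have -> : w * s ^+ 2 + w^-1 - 2 * s = w^-1 * (w * s - 1) ^+ 2.
      by field; rewrite gt_eqF.
    apply: mulr_ge0; first by rewrite invr_ge0 ltW.
    by rewrite real_exprn_even_ge0 // rpredB ?rpredM ?ger0_real // ltW.
  rewrite mulrDr lerD2r ler_piMl //.
  by rewrite mulr_ge0 ?exprn_ge0 // ltW.
rewrite ES /mxtrace; apply: (le_trans (ler_norm_sum _ _ _)).
apply: (@le_trans _ _ (\sum_i \sum_j `|A i j| * `|S j i|)).
  apply: ler_sum => i _; rewrite mxE; apply: (le_trans (ler_norm_sum _ _ _)).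
  by apply: ler_sum => j _; rewrite normrM.
apply: (le_trans (ler_sum _ (fun i _ => ler_sum _ (fun j _ => ent i j)))).
under eq_bigr => i _ do rewrite big_split big_split /=.
rewrite !big_split /=.
have -> : \sum_i \sum_j 2^-1 * (`|A i j| / (y i + y j)) =
    2^-1 * \sum_i \sum_j `|A i j| / (y i + y j).
  by rewrite mulr_sumr; apply: eq_bigr => i _; rewrite mulr_sumr.
rewrite lerD2r [X in _ + X]exchange_big /=.
have -> : \sum_j \sum_i 2^-1 * (y j * `|S j i| ^+ 2) = 2^-1 * \sum_i y i.
  rewrite mulr_sumr; apply: eq_bigr => j _.
  by rewrite -mulr_sumr -mulr_sumr unitarymx_row_sum // mulr1.
have -> : \sum_i \sum_j 2^-1 * (y i * `|S j i| ^+ 2) = 2^-1 * \sum_i y i.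
  rewrite mulr_sumr; apply: eq_bigr => j _; rewrite -mulr_sumr -mulr_sumr.
  rewrite (eq_bigr (fun i => `|S^T j i| ^+ 2)) => [|i _]; last by rewrite mxE.
  by rewrite unitarymx_row_sum ?mulr1 // trmx_unitary.
by rewrite ![2^-1 * _]mulrC -splitr.
Qed.

(** * Parent histories and the star bound on the energy *)

(* Entry [k] of a history is the parent of vertex [k + 1]; vertex [0] has none. *)
Definition children (s : seq nat) (v : nat) : nat := count_mem v s.

Definition history_of (n : nat) (par : parent_fun n.+1) : seq nat :=
  [seq val (par (lift ord0 j)) | j <- enum 'I_n].

Lemma size_history_of (n : nat) (par : parent_fun n.+1) :
  size (history_of n par) = n.
Proof. by rewrite size_map size_enum_ord. Qed.

Lemma nth_history_of (n : nat) (par : parent_fun n.+1) (j : 'I_n) :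
  nth 0%N (history_of n par) j = par (lift ord0 j).
Proof. by rewrite (nth_map j) ?size_enum_ord // nth_ord_enum. Qed.

Lemma tree_adj_normal (n : nat) (par : parent_fun n) :
  tree_adj par \is normalmx.
Proof.
apply/hermitian_normalmx/realsym_hermsym.
  apply/is_hermitianmxP; rewrite expr0 scale1r.
  by apply/matrixP => i j; rewrite !mxE orbC.
by apply/mxOverP => i j; rewrite mxE; case: ifP.
Qed.

Lemma valid_parent_lt {n : nat} {par : parent_fun n} (k : 'I_n) :
  valid_parent par -> (0 < k)%N -> (par k < k)%N.
Proof. by move=> /forallP /(_ k); case: eqP => [/= ->|]. Qed.

(** The upper end of every edge has a child, so weights that vanish at leaves are admissible in
    [mx_energy_le]. Each edge occurs there in both orders, which cancels the factor [2^-1]. *)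
Lemma tree_energy_le (n : nat) (par : parent_fun n.+1) (y : nat -> rat)
    (s := history_of n par) :
  valid_parent par -> (forall c, 0 <= y c) -> (forall c, (0 < c)%N -> 0 < y c) ->
  mx_energy (tree_adj par) <=
    ratr (\sum_(v < n.+1) y (children s v) +
          \sum_(k < n) (y (children s (nth 0%N s k)) + y (children s k.+1))^-1).
Proof.
move=> vp y0 y1.
pose z (v : nat) : algC := ratr (y (children s v)).
have z0 v : 0 <= z v by rewrite ler0q.
have par0 (k : 'I_n) : 0 < z (par (lift ord0 k)).
  rewrite ltr0q y1 // -has_count has_pred1 -nth_history_of.
  by rewrite mem_nth // size_history_of.
have A01 i j : tree_adj par i j != 0 -> 0 < z i + z j.
  rewrite mxE; case: ifP => [h _|]; last by rewrite eqxx.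
  case/orP: h => /andP[h /eqP e].
    case: (unliftP ord0 i) e h => [k ->|->] // <- _.
    by rewrite ltr_wpDl.
  case: (unliftP ord0 j) e h => [k ->|->] // <- _.
  by rewrite ltr_wpDr.
apply: (le_trans (mx_energy_le _ (fun i => z i) (tree_adj_normal _ par) _ _ _)) => //.
  by move=> i j; rewrite mxE; case: ifP; rewrite ?normr1 ?normr0.
rewrite rmorphD !rmorph_sum /= lerD2l.
(* Orient the edges: [B i j] marks [j] as the parent of [i], so each row other than that of vertex 0
   keeps a single term. *)
pose B (i j : 'I_n.+1) : algC := ((j < i)%N && (par i == j))%:R.
have AB i j : `|tree_adj par i j| = B i j + B j i.
  rewrite mxE /B; case: ltngtP => _ /=; rewrite ?orbF ?addr0 ?add0r ?normr0 //.
    by case: ifP; rewrite ?normr1 ?normr0.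
  by case: ifP; rewrite ?normr1 ?normr0.
under eq_bigr => i _ do under eq_bigr => j _ do rewrite AB mulrDl.
under eq_bigr => i _ do rewrite big_split /=.
rewrite big_split /= [X in _ + X]exchange_big /=.
under [X in _ + X]eq_bigr => i _ do under eq_bigr => j _ do rewrite [z j + z i]addrC.
rewrite [_^-1 * _]mulrC -mulr2n -[_ *+ 2]mulr_natr mulfK ?pnatr_eq0 //.
rewrite big_ord_recl big1 ?add0r => [|j _]; last by rewrite /B ltn0 mul0r.
apply: ler_sum => k _.
rewrite (bigD1 (par (lift ord0 k))) //= big1 ?addr0 => [|j jk]; last first.
  by rewrite /B [_ == j]eq_sym (negPf jk) andbF mul0r.
rewrite /B (valid_parent_lt _ vp) // eqxx mul1r.
by rewrite fmorphV rmorphD /= nth_history_of addrC.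
Qed.

(** Double counting that turns a sum over edges into a sum over parents, that is, over stars. *)
Lemma sum_children (m : nat) (s : seq nat) (g : nat -> rat) :
  (forall k, (k < size s)%N -> (nth 0%N s k < m)%N) ->
  \sum_(k < size s) g (nth 0%N s k) = \sum_(v < m) (children s v)%:R * g v.
Proof.
elim/last_ind: s => [_|s x IH hs].
  by rewrite big_ord0 big1 // => v _; rewrite mul0r.
rewrite size_rcons big_ord_recr /= nth_rcons ltnn eqxx.
have xm : (x < m)%N by move: (hs (size s)); rewrite size_rcons nth_rcons ltnn eqxx; apply.
transitivity (\sum_(k < size s) g (nth 0%N s k) + g x).
  by congr (_ + _); apply: eq_bigr => k _; rewrite nth_rcons ltn_ord.
rewrite IH; last first.
  move=> k ks; move: (hs k); rewrite size_rcons nth_rcons ks; apply; exact: ltnW.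
have -> : g x = \sum_(v < m) (x == v :> nat)%:R * g v.
  rewrite (bigD1 (Ordinal xm)) //= eqxx mul1r big1 ?addr0 // => v.
  by rewrite -val_eqE /= eq_sym => /negPf->; rewrite mul0r.
rewrite -big_split /=; apply: eq_bigr => v _.
by rewrite /children -cats1 count_cat /= addn0 natrD mulrDl.
Qed.

(** The index is the number of children: the degree at the root, the degree less one elsewhere. *)
Definition degree_count (k : nat) (s : seq nat) : rat :=
  \sum_(v < (size s).+1) (children s v == k)%:R.

(** Indexed by edges: edge [k] has [k.+1] as its child end. Among the edges to only children, these
    are the ones whose cost is not improved. *)
Definition leaf_only (s : seq nat) (k : nat) : bool :=
  (children s (nth 0%N s k) == 1%N) && (children s k.+1 == 0%N).

Definition leaf_only_child_count (s : seq nat) : rat :=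
  \sum_(k < size s) (leaf_only s k)%:R.

(** Each vertex pays its weight and [1 / y] per edge to a child. The last term credits [1 / 2] for
    every only child that is not a leaf. *)
Definition star_cost (y : nat -> rat) (s : seq nat) : rat :=
  \sum_(v < (size s).+1) (y (children s v) + (children s v)%:R / y (children s v))
  - 2^-1 * (degree_count 1 s - leaf_only_child_count s).

Lemma star_cost_ge (y : nat -> rat) (m : nat) (s : seq nat) :
  size s = m -> (forall k, (k < m)%N -> (nth 0%N s k <= k)%N) ->
  (forall c, 0 <= y c) -> (forall c, (0 < c)%N -> 1 <= y c) -> y 1%N = 1 ->
  \sum_(v < m.+1) y (children s v) +
  \sum_(k < m) (y (children s (nth 0%N s k)) + y (children s k.+1))^-1
  <= star_cost y s.
Proof.
move=> <- {m} hs y0 y1 y11; rewrite /star_cost big_split /= -addrA lerD2l.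
have hm k : (k < size s)%N -> (nth 0%N s k < (size s).+1)%N.
  by move=> ks; rewrite ltnS (leq_trans (hs _ ks)) // ltnW.
rewrite -(sum_children _ _ (fun v => (y (children s v))^-1) hm).
(* A vertex with one child has one edge to it, so the credit can also be distributed over edges and
   the bound checked edge by edge. *)
have -> : degree_count 1 s = \sum_(k < size s) (children s (nth 0%N s k) == 1%N)%:R.
  rewrite (sum_children _ _ (fun v => (children s v == 1%N)%:R) hm).
  by apply: eq_bigr => v _; case: eqVneq => [->|_]; [rewrite mulr1|rewrite mulr0].
rewrite /leaf_only_child_count -sumrB mulr_sumr -sumrB.
apply: ler_sum => k _; rewrite /leaf_only; set c := children s _; set d := children s _.
have c0 : (0 < c)%N by rewrite -has_count has_pred1 mem_nth.
have yc := y1 _ c0; have yd := y0 d.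
case: (eqVneq c 1%N) => [->|_] /=; last first.
  by rewrite subrr mulr0 subr0 lef_pV2 ?lerDl // posrE; lra.
rewrite y11; case: (posnP d) => [->|d0] /=.
  by rewrite subrr mulr0 subr0 lef_pV2 ?lerDl ?y0 // posrE ?ltr01 // ltr_wpDr.
have yd1 := y1 _ d0; rewrite subr0 mulr1.
have -> : 1^-1 - 2^-1 = (2^-1 : rat) by [].
by rewrite lef_pV2 ?posrE //; lra.
Qed.

(** * The attachment process on histories *)

Fixpoint histories (m : nat) : seq (seq nat) :=
  if m is m'.+1 then [seq rcons s v | s <- histories m', v <- iota 0 m'.+1]
  else [:: [::]].

Lemma mem_histories (m : nat) (s : seq nat) :
  reflect (size s = m /\ forall k, (k < m)%N -> (nth 0%N s k <= k)%N)
          (s \in histories m).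
Proof.
elim: m s => [|m IH] s.
  rewrite inE; apply: (iffP eqP) => [->|[/size0nil]] //.
apply: (iffP allpairsP) => [[[t v] [/IH [st ht]]]|[ss hs]].
  rewrite mem_iota add0n => vm ->; rewrite size_rcons st; split=> // k.
  by rewrite ltnS nth_rcons st; case: ltngtP => // [/ht|->].
case/lastP: s => [|t v] in ss hs *; first by [].
move: ss; rewrite size_rcons => -[st].
exists (t, v); split=> //.
  apply/IH; split=> // k km; have := hs k (ltnW km).
  by rewrite nth_rcons st km.
by rewrite mem_iota add0n /=; have := hs m (leqnn _); rewrite nth_rcons st ltnn eqxx.
Qed.

Lemma histories_uniq (m : nat) : uniq (histories m).
Proof.
elim: m => [//|m IH]; apply: allpairs_uniq; rewrite ?iota_uniq //.
by move=> [s v] [t w] _ _ /= /rcons_inj [-> ->].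
Qed.

(** A tree with [size s] edges has total degree [2 * size s], and [0 < v] counts the edge of [v] to
    its parent. The empty history is a single vertex of degree 0, which the second vertex joins with
    certainty. *)
Definition attach (s : seq nat) (v : nat) : rat :=
  if s is [::] then 1 else (children s v + (0 < v))%:R / (2 * size s)%:R.

Definition history_prob (s : seq nat) : rat :=
  \prod_(k < size s) attach (take k s) (nth 0%N s k).

Definition expect (m : nat) (F : seq nat -> rat) : rat :=
  \sum_(s <- histories m) history_prob s * F s.

(** The conditional expectation of [F] one step later, given the history [s]. *)
Definition step_expect (F : seq nat -> rat) (s : seq nat) : rat :=
  \sum_(v < (size s).+1) attach s v * F (rcons s v).

Lemma attach_ge0 s v : 0 <= attach s v.
Proof. by case: s => // x s; rewrite divr_ge0 ?ler0n. Qed.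

Lemma history_prob_ge0 s : 0 <= history_prob s.
Proof. by apply: prodr_ge0 => k _; apply: attach_ge0. Qed.

Lemma history_prob_rcons s v :
  history_prob (rcons s v) = history_prob s * attach s v.
Proof.
rewrite /history_prob size_rcons big_ord_recr /=.
rewrite nth_rcons ltnn eqxx -cats1 take_size_cat //; congr (_ * _).
apply: eq_bigr => k _.
by rewrite take_cat nth_cat ltn_ord.
Qed.

Lemma expect_step m F : expect m.+1 F = expect m (step_expect F).
Proof.
rewrite /expect big_allpairs_dep; apply: eq_big_seq => s /mem_histories [sm _].
rewrite /step_expect mulr_sumr sm.
rewrite -(val_enum_ord m.+1) big_map big_enum /=.
by apply: eq_bigr => v _; rewrite history_prob_rcons mulrA.
Qed.

Lemma expect_le m F G : (forall s, s \in histories m -> F s <= G s) ->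
  expect m F <= expect m G.
Proof.
move=> h; rewrite /expect big_seq [leRHS]big_seq; apply: ler_sum => s sm.
by rewrite ler_wpM2l ?history_prob_ge0 ?h.
Qed.

Lemma eq_expect m F G : (forall s, s \in histories m -> F s = G s) ->
  expect m F = expect m G.
Proof. by move=> h; apply: eq_big_seq => s sm; rewrite h. Qed.

Lemma expectD m F G : expect m (fun s => F s + G s) = expect m F + expect m G.
Proof. by rewrite -big_split; apply: eq_bigr => s _; rewrite mulrDr. Qed.

Lemma expectZ m c F : expect m (fun s => c * F s) = c * expect m F.
Proof. by rewrite mulr_sumr; apply: eq_bigr => s _; rewrite mulrCA. Qed.

Lemma sum_children_size (m : nat) (s : seq nat) :
  (forall k, (k < size s)%N -> (nth 0%N s k < m)%N) ->
  \sum_(v < m) (children s v)%:R = (size s)%:R :> rat.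
Proof.
move=> hs; have := sum_children m s (fun=> 1) hs.
rewrite sumr_const card_ord => ->.
by apply: eq_bigr => v _; rewrite mulr1.
Qed.

Lemma history_bound {m s} : s \in histories m ->
  forall k, (k < size s)%N -> (nth 0%N s k < (size s).+1)%N.
Proof.
by move=> /mem_histories [-> h] k km; rewrite ltnS (leq_trans (h _ km)) // ltnW.
Qed.

Lemma attach_pos s v : (0 < size s)%N ->
  attach s v = ((children s v)%:R + (0 < v)%N%:R) / (2 * (size s)%:R).
Proof. by case: s => // x s _; rewrite /attach natrD natrM. Qed.

(** Handshake: the numbers of children add up to [size s], and so do the parent edges of the
    [size s] vertices other than the root. *)
Lemma sum_attach m s : s \in histories m -> \sum_(v < (size s).+1) attach s v = 1.
Proof.
move=> sm; case: (posnP (size s)) => [/size0nil ->|s0].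
  by rewrite big_ord1.
under eq_bigr => v _ do rewrite attach_pos //.
rewrite -mulr_suml big_split /= (sum_children_size _ _ (history_bound sm)).
rewrite [X in _ + X]big_ord_recl /= add0r sumr_const card_ord.
by rewrite -mulr2n -[_ *+ 2]mulr_natl divff // mulf_neq0 // pnatr_eq0 -lt0n.
Qed.

Lemma expect1 m : expect m (fun=> 1) = 1.
Proof.
elim: m => [|m IH].
  by rewrite /expect /= big_seq1 /history_prob big_ord0 mulr1.
rewrite expect_step -[RHS]IH; apply: eq_expect => s sm.
by rewrite -[RHS](sum_attach _ _ sm); apply: eq_bigr => v _; rewrite mulr1.
Qed.

(** * Transfer between parent functions and histories *)

(** Histories omit the value at vertex 0, which validity fixes. *)
Lemma history_of_inj (n : nat) :
  {in [pred par : parent_fun n.+1 | valid_parent par] &,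
    injective (history_of n)}.
Proof.
move=> p q /= vp vq e; apply/ffunP => k.
case: (unliftP ord0 k) => [j ->|->]; apply: val_inj.
  by rewrite /= -!nth_history_of e.
by have /forallP /(_ ord0) /= /eqP -> := vp; have /forallP /(_ ord0) /= /eqP -> := vq.
Qed.

Lemma history_of_mem (n : nat) (par : parent_fun n.+1) :
  valid_parent par -> history_of n par \in histories n.
Proof.
move=> vp; apply/mem_histories; split; first exact: size_history_of.
move=> k kn; rewrite (nth_history_of _ _ (Ordinal kn)).
by have := valid_parent_lt (lift ord0 (Ordinal kn)) vp isT; rewrite /= /bump add1n ltnS.
Qed.

Lemma history_of_surj (n : nat) (s : seq nat) : s \in histories n ->
  exists2 par : parent_fun n.+1, valid_parent par & s = history_of n par.
Proof.
move=> /mem_histories [sn hs].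
pose par : parent_fun n.+1 := [ffun k => inord (if val k is k'.+1 then nth 0%N s k' else 0%N)].
have parE (j : 'I_n) : par (lift ord0 j) = nth 0%N s j :> nat.
  rewrite ffunE /= inordK // ltnS.
  by rewrite (leq_trans (hs _ (ltn_ord j))) // ltnW.
exists par.
  apply/forallP => k; case: (unliftP ord0 k) => [j ->|->] /=.
    by rewrite parE /bump /= add1n ltnS hs.
  by rewrite ffunE /= inordK.
apply: (@eq_from_nth _ 0%N); rewrite sn ?size_history_of // => k kn.
by rewrite (nth_history_of _ _ (Ordinal kn)) parE.
Qed.

Lemma BA_prob_history (n : nat) (par : parent_fun n.+1) : valid_parent par ->
  BA_prob par = history_prob (history_of n par).
Proof.
move=> vp; rewrite /BA_prob vp big_mkcond big_ord_recl /= mul1r.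
rewrite /history_prob size_history_of; apply: eq_bigr => j _.
rewrite /attach_prob nth_history_of /=.
case: (posnP j) => [j0|j0].
  by rewrite /bump /= add1n j0 take0.
rewrite attach_pos; last by rewrite size_take size_history_of ltn_ord.
have /negPf -> : bump 0 j != 1%N by rewrite /bump add1n eqSS -lt0n.
rewrite size_take size_history_of ltn_ord /bump add1n /= natrM -natrD.
congr ((_ + _)%:R / _).
rewrite /children /deg_before /=.
set v := par (lift ord0 j).
(* Vertex [j + 1] sees children among the vertices [1..j], which are the first [j] entries of the
   history. *)
rewrite -sum1dep_card big_mkcond big_ord_recl /= add0n.
rewrite -sum1_count (big_nth 0%N) size_take size_history_of ltn_ord big_mkord.
rewrite (big_ord_widen_cond n (fun i => pred1 (val v) (nth 0%N (take j (history_of n par)) i))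
  (fun=> 1%N)) ?(ltnW (ltn_ord j)) // [RHS]big_mkcond; apply: eq_bigr => i _.
rewrite andbC; congr (if _ then _ else _); rewrite ltnS.
case: (ltnP i j) => ij; last by rewrite !andbF.
by rewrite !andbT nth_take // nth_history_of -val_eqE.
Qed.

(** Invalid parent functions have probability 0, and [history_of] is a bijection from the valid ones
    onto [histories n]. *)
Lemma expect_parent (n : nat) (F : seq nat -> rat) :
  \sum_(par : parent_fun n.+1) BA_prob par * F (history_of n par) = expect n F.
Proof.
rewrite (bigID (@valid_parent n.+1)) /= [X in _ + X]big1 ?addr0; last first.
  by move=> par /negPf nv; rewrite /BA_prob nv mul0r.
transitivity (\sum_(par : parent_fun n.+1 | valid_parent par)
   history_prob (history_of n par) * F (history_of n par)).
  by apply: eq_bigr => par vp; rewrite BA_prob_history.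
rewrite -big_enum -(big_map (history_of n) xpredT (fun s => history_prob s * F s)).
apply: perm_big; apply: uniq_perm.
- rewrite map_inj_in_uniq ?enum_uniq // => p q.
  by rewrite !mem_enum; apply: history_of_inj.
- exact: histories_uniq.
move=> s; apply/mapP/idP => [[par]|/history_of_surj [par vp ->]].
  by rewrite mem_enum => vp ->; apply: history_of_mem.
by exists par; rewrite // mem_enum.
Qed.

(** * Concentration around a linear mean *)

(** The deviation is taken from [x * m] instead of the exact mean, so expectations need no
    computation; [m.+1] leaves room for a constant at [m = 0]. *)
Definition concentrated (X : seq nat -> rat) (x : rat) : Prop :=
  exists D, forall m, expect m (fun s => (X s - x * m%:R) ^+ 2) <= D * m.+1%:R.

Lemma expect_ge0 m F : (forall s, s \in histories m -> 0 <= F s) -> 0 <= expect m F.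
Proof.
move=> h; rewrite /expect big_seq; apply: sumr_ge0 => s sm.
by rewrite mulr_ge0 ?history_prob_ge0 ?h.
Qed.

Lemma concentratedD X Y x y : concentrated X x -> concentrated Y y ->
  concentrated (fun s => X s + Y s) (x + y).
Proof.
move=> [D hD] [D' hD']; exists (2 * D + 2 * D') => m.
apply: (@le_trans _ _ (2 * expect m (fun s => (X s - x * m%:R) ^+ 2)
   + 2 * expect m (fun s => (Y s - y * m%:R) ^+ 2))).
  rewrite -!expectZ -expectD; apply: expect_le => s _.
  set u := X s; set v := Y s; set n := m%:R.
  rewrite -subr_ge0.
  have -> : 2 * (u - x * n) ^+ 2 + 2 * (v - y * n) ^+ 2 - (u + v - (x + y) * n) ^+ 2
    = (u - x * n - (v - y * n)) ^+ 2 by ring.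
  by rewrite sqr_ge0.
by move: (hD m) (hD' m); lra.
Qed.

Lemma concentratedZ c X x : concentrated X x -> concentrated (fun s => c * X s) (c * x).
Proof.
move=> [D hD]; exists (c ^+ 2 * D) => m.
rewrite (eq_expect _ _ (fun s => c ^+ 2 * (X s - x * m%:R) ^+ 2)).
  by rewrite expectZ -[leRHS]mulrA ler_wpM2l ?sqr_ge0.
by move=> s _; rewrite -exprMn mulrBr mulrA.
Qed.

Lemma eq_concentrated X Y x :
  (forall m s, s \in histories m -> X s = Y s) -> concentrated X x -> concentrated Y x.
Proof.
move=> h [D hD]; exists D => m; rewrite (eq_expect _ _ (fun s => (X s - x * m%:R) ^+ 2)) //.
by move=> s sm; rewrite (h _ _ sm).
Qed.

Lemma concentrated_size : concentrated (fun s => (size s)%:R) 1.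
Proof.
exists 0 => m; rewrite mul0r (eq_expect _ _ (fun=> 0 * 1)) ?expectZ ?mul0r //.
by move=> s /mem_histories [-> _]; rewrite mul1r subrr.
Qed.

Lemma concentrated_cst c : concentrated (fun=> c) 0.
Proof.
exists (c ^+ 2) => m; rewrite (eq_expect _ _ (fun=> c ^+ 2 * 1)).
  by rewrite expectZ expect1 ler_wpM2l ?sqr_ge0 // ler1n.
by move=> s _; rewrite mul0r subr0 mulr1.
Qed.

(** Expand the square around [U s]: the cross term averages to the drift and the squared increment
    is at most [B ^+ 2]. *)
Lemma step_expect_sqr m s (U : seq nat -> rat) (B : rat) : s \in histories m ->
  (forall v, (v <= m)%N -> `|U (rcons s v) - U s| <= B) ->
  step_expect (fun t => U t ^+ 2) s <=
    U s ^+ 2 + 2 * U s * (step_expect U s - U s) + B ^+ 2.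
Proof.
move=> sm hB; have ss : size s = m by case/mem_histories: sm.
apply: (@le_trans _ _
  (step_expect (fun t => 2 * U s * U t + (B ^+ 2 - U s ^+ 2)) s)).
  apply: ler_sum => v _; rewrite ler_wpM2l ?attach_ge0 //.
  have vm : (v <= m)%N by rewrite -ss -ltnS.
  have B0 : 0 <= B by apply: le_trans (normr_ge0 _) (hB v vm).
  have : (U (rcons s v) - U s) ^+ 2 <= B ^+ 2.
    by rewrite -(real_normK (num_real _)) ler_sqr ?nnegrE ?normr_ge0 ?hB.
  nra.
have -> : step_expect (fun t => 2 * U s * U t + (B ^+ 2 - U s ^+ 2)) s =
    2 * U s * step_expect U s + (B ^+ 2 - U s ^+ 2).
  rewrite /step_expect mulr_sumr; under eq_bigr => v _ do rewrite mulrDr mulrCA.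
  by rewrite big_split /= -mulr_suml (sum_attach _ _ sm) mul1r.
nra.
Qed.

Lemma history_bounded_growth (X : seq nat -> rat) (C : rat) m s :
  (forall m s v, s \in histories m -> (v <= m)%N -> `|X (rcons s v) - X s| <= C) ->
  s \in histories m -> `|X s| <= C * m%:R + `|X [::]|.
Proof.
move=> h; elim: m s => [|m IH] s.
  by rewrite inE => /eqP ->; rewrite mulr0 add0r.
move=> /allpairsP [[t v] [tm]]; rewrite mem_iota add0n ltnS => vm ->.
have := h _ _ _ tm vm; have := IH _ tm; rewrite [(t, v).1]/= [(t, v).2]/=.
have := ler_normD (X (rcons t v) - X t) (X t); rewrite subrK -[m.+1]addn1 natrD.
lra.
Qed.

(* With [U = X - x m] and [V = Y - y m] the relation on [x] turns the drift
   into [(b V - l U) / (2 m) + O(1 / m)], hence [E U^2] grows by a bounded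
   amount at each step since [2 U (b V - l U) / (2 m) <= b^2 V^2 / (4 l m)]. *)
Lemma concentrated_drift (X Y : seq nat -> rat) (x y k l b C : rat) :
  0 < l -> concentrated Y y ->
  (forall m s v, s \in histories m -> (v <= m)%N -> `|X (rcons s v) - X s| <= C) ->
  (forall m s, s \in histories m -> (0 < m)%N ->
     `|step_expect X s - X s - (k + (b * Y s - l * X s) / (2 * m%:R))| <= C / m%:R) ->
  x * (1 + l / 2) = k + b * y / 2 ->
  concentrated X x.
Proof.
move=> l0 [DY hY] hB hS hx.
have C0 : 0 <= C.
  by apply: le_trans (hB 0%N [::] 0%N _ _); rewrite ?normr_ge0 // inE.
have DY0 : 0 <= DY.
  have := hY 0%N; rewrite mulr1; apply: le_trans.
  by apply: expect_ge0 => s _; rewrite sqr_ge0.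
(* Centring with [size s] makes [U] a function of the history alone, as [step_expect] requires. *)
pose U s := X s - x * (size s)%:R.
pose B := C + `|x|; pose X0 := `|X [::]|.
have B0 : 0 <= B by rewrite addr_ge0.
have X00 : 0 <= X0 by apply: normr_ge0.
have hU m s v : s \in histories m -> (v <= m)%N -> `|U (rcons s v) - U s| <= B.
  move=> sm vm; have := hB _ _ _ sm vm; have := ler_normB (X (rcons s v) - X s) x.
  rewrite /U /B size_rcons -[(size s).+1]addn1 natrD mulrDr mulr1.
  set w := X _ - X s - x.
  have -> : X (rcons s v) - (x * (size s)%:R + x) - (X s - x * (size s)%:R) = w.
    by rewrite /w; ring.
  lra.
have bU m s : s \in histories m -> `|U s| <= B * m%:R + X0.
  move=> /(history_bounded_growth _ _ _ _ hU); rewrite /U mulr0 subr0 //.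
(* The growth per step: the fluctuation of [Y], the drift error [C / m] against [|U| <= (B + X0) m],
   and the squared increment. *)
pose K := b ^+ 2 * DY / (2 * l) + 2 * C * (B + X0) + B ^+ 2.
have K0 : 0 <= K.
  have h1 : 0 <= b ^+ 2 * DY by rewrite mulr_ge0 ?sqr_ge0.
  have h2 : 0 <= 2 * C * (B + X0) by rewrite mulr_ge0 ?addr_ge0 // mulr_ge0.
  have h3 : 0 <= (2 * l)^-1 by rewrite invr_ge0 mulr_ge0 // ltW.
  have := mulr_ge0 h1 h3; have := sqr_ge0 B; rewrite /K; lra.
(* Covers [m = 0] and [m = 1], which precede the first use of the drift hypothesis. *)
pose K1 := (B + X0) ^+ 2 + X0 ^+ 2.
have K10 : 0 <= K1 by rewrite addr_ge0 ?sqr_ge0.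
suff H m : expect m (fun s => U s ^+ 2) <= (K + K1) * m.+1%:R.
  exists (K + K1) => m; rewrite (eq_expect _ _ (fun s => U s ^+ 2)) //.
  by move=> s /mem_histories [ss _]; rewrite /U ss.
elim: m => [|[_|m IH]].
- apply: (@le_trans _ _ (expect 0 (fun=> X0 ^+ 2 * 1))).
    apply: expect_le => s /bU; rewrite mulr0 add0r mulr1 => h.
    by rewrite -(real_normK (num_real (U s))) ler_sqr ?nnegrE.
  by rewrite expectZ expect1 !mulr1 /K1; nra.
- apply: (@le_trans _ _ (expect 1 (fun=> (B + X0) ^+ 2 * 1))).
    apply: expect_le => s /bU; rewrite !mulr1 => h.
    by rewrite -(real_normK (num_real (U s))) ler_sqr ?nnegrE // addr_ge0.
  by rewrite expectZ expect1 !mulr1 /K1; nra.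
set n := m.+1 in IH *; have n1 : 1 <= n%:R :> rat by rewrite ler1n.
have n0 : 0 < n%:R :> rat by lra.
rewrite expect_step.
apply: (@le_trans _ _ (expect n (fun s => U s ^+ 2 +
  (b ^+ 2 / (4 * l * n%:R) * (Y s - y * n%:R) ^+ 2 + (2 * C * (B + X0) + B ^+ 2) * 1)))).
  apply: expect_le => s sm; have ss : size s = n by case/mem_histories: sm.
  apply: (le_trans (step_expect_sqr n s U B sm _)); first by move=> v; apply: hU.
  rewrite -addrA lerD2l mulr1 addrA lerD2r.
  set V := Y s - y * n%:R.
  pose e := step_expect X s - X s - (k + (b * Y s - l * X s) / (2 * n%:R)).
  have he : `|e| <= C / n%:R by apply: hS.
  have -> : step_expect U s - U s = (b * V - l * U s) / (2 * n%:R) + e.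
    have -> : step_expect U s = step_expect X s - x * n.+1%:R.
      rewrite /step_expect; under eq_bigr => v _ do rewrite /U size_rcons mulrBr.
      by rewrite sumrB -mulr_suml (sum_attach _ _ sm) mul1r ss.
    rewrite /e /V /U ss -[n.+1]addn1 natrD.
    have -> : k = x * (1 + l / 2) - b * y / 2 by rewrite hx addrK.
    by field; rewrite gt_eqF.
  rewrite mulrDr; apply: lerD.
    rewrite -subr_ge0.
    (* Completing the square; the restoring term [- l * U s] absorbs the cross term. *)
    have -> : b ^+ 2 / (4 * l * n%:R) * V ^+ 2 - 2 * U s * ((b * V - l * U s) / (2 * n%:R))
      = (b * V - 2 * l * U s) ^+ 2 / (4 * l * n%:R).
      by field; rewrite !gt_eqF.
    by rewrite divr_ge0 ?sqr_ge0 // !mulr_ge0 // ltW.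
  apply: (le_trans (ler_norm _)); rewrite !normrM normr_nat.
  have hU1 : `|U s| <= (B + X0) * n%:R.
    by apply: le_trans (bU _ _ sm) _; nra.
  have -> : 2 * C * (B + X0) = 2 * ((B + X0) * n%:R) * (C / n%:R) :> rat.
    by field; rewrite gt_eqF.
  by rewrite ler_pM ?mulr_ge0 ?normr_ge0 // ler_wpM2l.
rewrite !expectD !expectZ expect1 mulr1.
have hV : b ^+ 2 / (4 * l * n%:R) * expect n (fun s => (Y s - y * n%:R) ^+ 2)
   <= b ^+ 2 * DY / (2 * l).
  have w0 : 0 <= b ^+ 2 / (4 * l * n%:R).
    by rewrite divr_ge0 ?sqr_ge0 // !mulr_ge0 // ltW.
  apply: (@le_trans _ _ (b ^+ 2 / (4 * l * n%:R) * (DY * (2 * n%:R)))).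
    rewrite (ler_wpM2l w0) // (le_trans (hY n)) //.
    by rewrite (ler_wpM2l DY0) // -[n.+1]addn1 natrD; lra.
  rewrite le_eqVlt; apply/orP; left; apply/eqP; field.
  by rewrite !gt_eqF.
move: IH hV; rewrite /K -[n.+2]addn1 natrD; lra.
Qed.

(** Chebyshev: on this event [X] deviates by at least [(1 - x) m], while the second moment is
    [O(m)]. *)
Lemma concentrated_tail X x : concentrated X x -> x < 1 ->
  exists D, forall m, (0 < m)%N ->
    expect m (fun s => (m%:R <= X s)%R%:R) <= D / m%:R.
Proof.
move=> [D hD] x1; exists (2 * D / (1 - x) ^+ 2) => m m0.
have m1 : 1 <= m%:R :> rat by rewrite ler1n.
set n : rat := m%:R in m1 *.
have n0 : 0 < n by lra.
have d0 : 0 < 1 - x by lra.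
apply: (@le_trans _ _ (expect m
  (fun s => ((1 - x) * n) ^- 2 * (X s - x * n) ^+ 2))).
  apply: expect_le => s _; rewrite mulrC ler_pdivlMr ?exprn_gt0 ?mulr_gt0 //.
  case: (lerP n (X s)) => [h|_] /=; last by rewrite mul0r sqr_ge0.
  by rewrite mul1r ler_sqr ?nnegrE ?mulr_ge0 //; nra.
rewrite expectZ.
apply: (@le_trans _ _ (((1 - x) * n) ^- 2 * (D * (2 * n)))).
  rewrite ler_wpM2l ?invr_ge0 ?sqr_ge0 //; apply: (le_trans (hD m)).
  have D0 : 0 <= D.
    have := hD 0%N; rewrite mulr1; apply: le_trans.
    by apply: expect_ge0 => s _; rewrite sqr_ge0.
  by rewrite ler_wpM2l // -[m.+1]addn1 natrD -/n; lra.
rewrite le_eqVlt; apply/orP; left; apply/eqP; field.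
by rewrite !gt_eqF.
Qed.

(** * Drift and limits of the degree counts *)

Lemma children_rcons s v u :
  children (rcons s v) u = (children s u + (v == u))%N.
Proof. by rewrite /children -cats1 count_cat /= addn0. Qed.

Lemma children_new m s u : s \in histories m -> (m < u)%N -> children s u = 0%N.
Proof.
move=> /mem_histories [sm hs] mu; apply/count_memPn/negP => /(nthP 0%N) [k].
by rewrite sm => km e; have := hs _ km; rewrite e; lia.
Qed.

(** The new vertex is a leaf, and [v] moves up by one class. *)
Lemma degree_count_rcons k m s v : s \in histories m -> (v <= m)%N ->
  degree_count k (rcons s v) - degree_count k s =
  (k == 0%N)%:R + ((children s v).+1 == k)%:R - (children s v == k)%:R.
Proof.
move=> sm vm; have ss : size s = m by case/mem_histories: (sm).
rewrite /degree_count size_rcons big_ord_recr /= children_rcons.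
rewrite (children_new _ _ _ sm) ?ss // (ltn_eqF (vm : v < m.+1)%N) addn0.
have vm1 : (v < m.+1)%N by rewrite ltnS.
rewrite (bigD1 (Ordinal vm1)) // [X in _ - X](bigD1 (Ordinal vm1)) //=.
rewrite children_rcons eqxx addn1 [0%N == k]eq_sym.
rewrite (eq_bigr (fun u : 'I_m.+1 => (children s u == k)%:R)); first by ring.
by move=> u; rewrite -val_eqE /= eq_sym children_rcons => /negPf ->; rewrite addn0.
Qed.

(** The attachment weight at a vertex with [c] children is [c + 1], except at the root, where it is
    [c]. The correction [g 0] is the source of the [O(1 / m)] errors in the drifts below. *)
Lemma sum_attach_mul s (g : nat -> rat) : (0 < size s)%N ->
  \sum_(v < (size s).+1) attach s v * g v =
  (\sum_(v < (size s).+1) (children s v).+1%:R * g v - g 0%N) / (2 * (size s)%:R).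
Proof.
move=> s0; under eq_bigr => v _ do rewrite attach_pos // mulrAC.
rewrite -mulr_suml; congr (_ / _).
rewrite big_ord_recl [in RHS]big_ord_recl /=.
rewrite (eq_bigr (fun i : 'I_(size s) => (children s (lift ord0 i)).+1%:R * g (lift ord0 i))).
  by rewrite mulrSr; ring.
by move=> v _; rewrite [in RHS]mulrSr.
Qed.

Lemma step_expect_incr m s (X : seq nat -> rat) (g : nat -> rat) (c : rat) :
  s \in histories m -> (0 < m)%N ->
  (forall v, (v <= m)%N -> X (rcons s v) - X s = c + g v) ->
  step_expect X s - X s = c +
    (\sum_(v < (size s).+1) (children s v).+1%:R * g v - g 0%N) / (2 * m%:R).
Proof.
move=> sm m0 h; have ss : size s = m by case/mem_histories: (sm).
rewrite -{1}ss -sum_attach_mul ?ss //.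
rewrite -{1}(mul1r (X s)) -{1}(mul1r c) -(sum_attach _ _ sm) /step_expect.
rewrite !mulr_suml -sumrB ss -big_split /=; apply: eq_bigr => v _.
by rewrite -mulrBr h ?mulrDr // -ltnS.
Qed.

Lemma norm_le1 (a b : bool) : `|a%:R - b%:R| <= 1 :> rat.
Proof. by case: a; case: b. Qed.

(** Class [k] gains from class [k - 1] with weight [k] and loses with weight [k + 1]. At [k = 0] the
    factor [k%:R] cancels the meaningless [k.-1]. *)
Lemma degree_count_drift k m s : s \in histories m -> (0 < m)%N ->
  `|step_expect (degree_count k) s - degree_count k s - ((k == 0%N)%:R +
     (k%:R * degree_count k.-1 s - k.+1%:R * degree_count k s) / (2 * m%:R))|
  <= 2 / m%:R.
Proof.
move=> sm m0.
pose g v : rat := ((children s v).+1 == k)%:R - (children s v == k)%:R.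
rewrite (step_expect_incr _ _ _ g (k == 0%N)%:R sm m0); last first.
  by move=> v vm; rewrite (degree_count_rcons _ _ _ _ sm vm) addrA.
have -> : \sum_(v < (size s).+1) (children s v).+1%:R * g v =
    k%:R * degree_count k.-1 s - k.+1%:R * degree_count k s.
  rewrite /degree_count !mulr_sumr -sumrB; apply: eq_bigr => v _.
  rewrite /g mulrBr; congr (_ - _); last by case: eqP => [->|_]; rewrite ?mulr0.
  case: k {g} => [|k] /=; first by rewrite mul0r mulr0.
  by rewrite eqSS; case: eqP => [->|_]; rewrite ?mulr0.
have n0 : 0 < m%:R :> rat by rewrite ltr0n.
set t := _ - _ * degree_count _ _.
have -> : (k == 0%N)%:R + (t - g 0%N) / (2 * m%:R) - ((k == 0%N)%:R + t / (2 * m%:R)) =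
   - g 0%N / 2 / m%:R by field; rewrite gt_eqF.
rewrite 2!normrM normrN [`|m%:R^-1|]gtr0_norm ?invr_gt0 //.
rewrite ler_wpM2r ?invr_ge0 ?ler0n //.
have := norm_le1 ((children s 0).+1 == k) (children s 0 == k); rewrite -/(g 0%N).
have -> : `|2^-1| = 2^-1 :> rat by [].
lra.
Qed.

Definition degree_limit (k : nat) : rat := 4 / ((k.+1)%:R * (k.+2)%:R * (k.+3)%:R).

Lemma concentrated_degree_count k :
  concentrated (degree_count k) (degree_limit k).
Proof.
have hB j m s v : s \in histories m -> (v <= m)%N ->
    `|degree_count j (rcons s v) - degree_count j s| <= 2.
  move=> sm vm; rewrite (degree_count_rcons _ _ _ _ sm vm).
  by case: (j == _); case: (_ == j); case: (_ == j).
elim: k => [|k IH].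
  (* Leaves have no class below them: the new vertex gives the constant gain 1, and the limit solves
     [x * (3 / 2) = 1]. *)
  apply: (concentrated_drift _ (fun=> 0) _ 0 1 1 0 2 _ (concentrated_cst 0) (hB _)) => //.
  move=> m s sm m0; rewrite mulr0; have := degree_count_drift 0 m s sm m0.
  by rewrite mul0r.
apply: (concentrated_drift _ _ _ _ 0 k.+2%:R k.+1%:R 2 _ IH (hB _)).
- by rewrite ltr0n.
- by move=> m s sm m0; have := degree_count_drift k.+1 m s sm m0.
rewrite /degree_limit -![k.+4]/(4 + k)%N -![k.+3]/(3 + k)%N -![k.+2]/(2 + k)%N.
rewrite -![k.+1]/(1 + k)%N !natrD.
have k0 : 0 <= k%:R :> rat by rewrite ler0n.
by field; rewrite !gt_eqF //; lra.
Qed.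

Lemma concentrated_sum (n : nat) (c : nat -> rat) (X : nat -> seq nat -> rat) (x : nat -> rat) :
  (forall k, concentrated (X k) (x k)) ->
  concentrated (fun s => \sum_(k < n) c k * X k s) (\sum_(k < n) c k * x k).
Proof.
move=> h; elim: n => [|n IH].
  rewrite big_ord0; apply: eq_concentrated (concentrated_cst 0) => m s _.
  by rewrite big_ord0.
rewrite big_ord_recr /=.
apply: eq_concentrated (concentratedD _ _ _ _ IH (concentratedZ (c n) _ _ (h n))) => m s _.
by rewrite big_ord_recr.
Qed.

(** The affine part sums to the deterministic [a (m + 1) + b m], since the numbers of children add
    up to [m]. Only the [K] classes where [f] departs from it are random, so no uniformity over all
    degrees is required. *)
Lemma concentrated_degree_sum (f : nat -> rat) (K : nat) (a b : rat) :
  (forall c, (K <= c)%N -> f c = a + b * c%:R) ->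
  concentrated (fun s => \sum_(v < (size s).+1) f (children s v))
    (a + b + \sum_(k < K) (f k - a - b * k%:R) * degree_limit k).
Proof.
move=> hf.
have h1 := concentratedD _ _ _ _ (concentratedZ (a + b) _ _ concentrated_size) (concentrated_cst a).
have h2 := concentrated_sum K (fun k => f k - a - b * k%:R) _ _ concentrated_degree_count.
have := concentratedD _ _ _ _ h1 h2; rewrite mulr1 addr0.
apply: eq_concentrated => m s sm.
have fE c : f c = a + b * c%:R + \sum_(k < K) (f k - a - b * k%:R) * (c == k)%:R.
  case: (ltnP c K) => cK.
    rewrite (bigD1 (Ordinal cK)) //= eqxx mulr1 big1 ?addr0; first by ring.
    by move=> k; rewrite -val_eqE /= eq_sym => /negPf ->; rewrite mulr0.
  rewrite big1 ?addr0 ?hf // => k _.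
  by rewrite gtn_eqF ?mulr0 // (leq_trans (ltn_ord k)).
under [RHS]eq_bigr => v _ do rewrite fE.
rewrite big_split big_split /=.
rewrite sumr_const card_ord -mulr_sumr (sum_children_size _ _ (history_bound sm)).
rewrite exchange_big /=; congr (_ + _).
  by rewrite -[a *+ _]mulr_natl mulrSr; ring.
by apply: eq_bigr => k _; rewrite mulr_sumr.
Qed.

(** * Drift and limit of the count of only children that are leaves *)

(** Attaching to either end of the edge destroys the property. The ends differ because the parent is
    at most [k], and an old edge never acquires the property since numbers of children only grow. *)
Lemma leaf_only_rcons s v k : (k < size s)%N -> (nth 0%N s k <= k)%N ->
  (leaf_only (rcons s v) k)%:R =
  (leaf_only s k)%:R - (leaf_only s k)%:R * ((v == nth 0%N s k)%:R + (v == k.+1)%:R) :> rat.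
Proof.
move=> ks hk; rewrite /leaf_only nth_rcons ks !children_rcons.
have : (0 < children s (nth 0%N s k))%N by rewrite -has_count has_pred1 mem_nth.
have [->|_] := eqVneq v (nth 0%N s k).
  rewrite (ltn_eqF (hk : nth 0%N s k < k.+1)%N) addn1 addr0 mulr1 subrr.
  by case: (children s _).
have [_|_] := eqVneq v k.+1.
  by rewrite addn1 andbF add0r mulr1 subrr.
by rewrite !addn0 addr0 mulr0 subr0.
Qed.

Lemma leaf_only_child_count_rcons m s v : s \in histories m -> (v <= m)%N ->
  leaf_only_child_count (rcons s v) - leaf_only_child_count s =
  (children s v == 0%N)%:R -
  \sum_(k < size s) (leaf_only s k)%:R * ((v == nth 0%N s k)%:R + (v == k.+1)%:R).
Proof.
move=> sm vm; have [ss hs] := mem_histories m s sm.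
rewrite /leaf_only_child_count size_rcons big_ord_recr /=.
have -> : leaf_only (rcons s v) (size s) = (children s v == 0%N).
  rewrite /leaf_only nth_rcons ltnn eqxx !children_rcons eqxx ss.
  rewrite (children_new _ _ m.+1 sm) //.
  by rewrite (ltn_eqF (vm : v < m.+1)%N) addn1 eqSS addn0 andbT.
have -> : \sum_(k < size s) (leaf_only (rcons s v) k)%:R = leaf_only_child_count s -
    \sum_(k < size s) (leaf_only s k)%:R * ((v == nth 0%N s k)%:R + (v == k.+1)%:R).
  rewrite -sumrB; apply: eq_bigr => k _.
  by rewrite -(leaf_only_rcons s v k) ?hs -?ss.
by rewrite -/(leaf_only_child_count s); ring.
Qed.

(** A nonzero term forces [v] to have exactly one child, so at most one edge contributes. *)
Lemma sum_leaf_only_bound s v :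
  0 <= (\sum_(k < size s) (leaf_only s k)%:R * (v == nth 0%N s k)%:R : rat) <= 1.
Proof.
rewrite sumr_ge0 => [|k _]; last by rewrite mulr_ge0.
apply: (@le_trans _ rat (\sum_(k < size s) (children s v == 1%N)%:R * (nth 0%N s k == v)%:R)).
  apply: ler_sum => k _; rewrite [nth _ _ _ == v]eq_sym.
  case: eqVneq => [->|_]; last by rewrite !mulr0.
  by rewrite !mulr1 /leaf_only; case: (_ == 1%N); case: (_ == 0%N).
rewrite -mulr_sumr.
have -> : \sum_(k < size s) (nth 0%N s k == v)%:R = (children s v)%:R :> rat.
  rewrite /children -sum1_count natr_sum (big_nth 0%N) big_mkord [RHS]big_mkcond /=.
  by apply: eq_bigr => k _; case: eqP.
by case: eqVneq => [->|_]; rewrite ?mul0r ?mulr1.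
Qed.

(** Up to the root correction, a gain means joining a leaf, of weight 1; a loss means joining the
    parent, of weight 2, or the child, of weight 1, hence the 3. *)
Lemma leaf_only_child_count_step m s : s \in histories m -> (0 < m)%N ->
  `|step_expect leaf_only_child_count s - leaf_only_child_count s - (0 +
     (1 * degree_count 0 s - 3 * leaf_only_child_count s) / (2 * m%:R))|
  <= 2 / m%:R.
Proof.
move=> sm m0; have [ss hs] := mem_histories m s sm.
pose g v : rat := (children s v == 0%N)%:R -
  \sum_(k < size s) (leaf_only s k)%:R * ((v == nth 0%N s k)%:R + (v == k.+1)%:R).
rewrite (step_expect_incr _ _ _ g 0 sm m0) => [|v vm]; last first.
  by rewrite add0r; apply: leaf_only_child_count_rcons vm.
have n0 : 0 < m%:R :> rat by rewrite ltr0n.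
have -> : \sum_(v < (size s).+1) (children s v).+1%:R * g v =
    degree_count 0 s - 3 * leaf_only_child_count s.
  have gE v : (children s v).+1%:R * g v = (children s v == 0%N)%:R -
    \sum_(k < size s) (leaf_only s k)%:R *
      (2 * (v == nth 0%N s k)%:R + (v == k.+1)%:R).
    rewrite /g mulrBr; congr (_ - _); first by case: eqVneq => [->|_]; rewrite ?mulr0.
    rewrite mulr_sumr; apply: eq_bigr => k _; rewrite mulrCA.
    rewrite /leaf_only; case: eqVneq => [e1|_]; last by rewrite !mul0r.
    case: eqVneq => [e2|_]; last by rewrite !mul0r.
    rewrite !mul1r mulrDr; congr (_ + _).
      by case: eqVneq => [->|_]; rewrite ?mulr0 // e1.
    by case: eqVneq => [->|_]; rewrite ?mulr0 // e2.
  under eq_bigr => v _ do rewrite gE.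
  rewrite sumrB exchange_big /=; congr (_ - _).
  rewrite /leaf_only_child_count mulr_sumr; apply: eq_bigr => k _.
  rewrite -mulr_sumr big_split -mulr_sumr /= mulrC; congr (_ * _).
  have one u : (u < (size s).+1)%N -> \sum_(v < (size s).+1) (v == u :> nat)%:R = 1 :> rat.
    move=> us; rewrite (bigD1 (Ordinal us)) //= eqxx big1 ?addr0 // => v.
    by rewrite -val_eqE /= => /negPf ->.
  by rewrite !one ?ltnS // (leq_trans (hs _ _)) -?ss // ltnW.
have gb : -2 <= g 0%N <= 1.
  rewrite /g; under eq_bigr => k _ do rewrite addr0.
  have /andP[] := sum_leaf_only_bound s 0; case: (_ == 0%N) => /=; lra.
set t := _ - _ * leaf_only_child_count _.
have -> : 0 + (t - g 0%N) / (2 * m%:R) -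
    (0 + (1 * degree_count 0 s - 3 * leaf_only_child_count s) / (2 * m%:R)) =
   - g 0%N / 2 / m%:R by rewrite /t; field; rewrite gt_eqF.
rewrite normrM [`|m%:R^-1|]gtr0_norm ?invr_gt0 //.
rewrite ler_wpM2r ?invr_ge0 ?ler0n // ler_norml; lra.
Qed.

Lemma concentrated_leaf_only_child_count :
  concentrated leaf_only_child_count (2 / 15).
Proof.
(* The limit fraction of leaves is [2 / 3], and [x * (1 + 3 / 2) = (2 / 3) / 2] gives [2 / 15]. *)
apply: (concentrated_drift _ _ _ _ 0 3 1 2 _ (concentrated_degree_count 0)) => //.
- move=> m s v sm vm; rewrite (leaf_only_child_count_rcons _ _ _ sm vm).
  under eq_bigr => k _ do rewrite mulrDr.
  rewrite big_split /=.
  have /andP[] := sum_leaf_only_bound s v.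
  have : 0 <= (\sum_(k < size s) (leaf_only s k)%:R * (v == k.+1)%:R : rat) <= 1.
    rewrite sumr_ge0 => [|k _]; last by rewrite mulr_ge0.
    case: v vm => [|v] vm; first by rewrite big1 // => k _; rewrite mulr0.
    case: (ltnP v (size s)) => vs; last first.
      rewrite big1 // => k _; rewrite eqSS gtn_eqF ?mulr0 //.
      exact: leq_trans (ltn_ord k) vs.
    rewrite (bigD1 (Ordinal vs)) //= eqxx mulr1 big1 ?addr0 => [|k].
      by case: leaf_only.
    by rewrite -val_eqE /= eq_sym eqSS => /negPf ->; rewrite mulr0.
  by move=> /andP[]; rewrite ler_norml; case: (_ == 0%N) => /=; lra.
exact: leaf_only_child_count_step.
Qed.

(** * Choice of the weights and the numerical bound *)

(* Approximations of the square root, which minimizes [a + c / a]; the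
   constant tail makes the cost [y c + c / y c] affine for large [c]. *)
Definition star_weight (c : nat) : rat :=
  nth 5 [:: 0; 1; 7/5; 7/4; 2; 9/4; 5/2; 8/3; 17/6; 3; 19/6; 10/3] c.

Lemma star_weight_ge1 c : (0 < c)%N -> 1 <= star_weight c.
Proof. by do 12! [case: c => [|c] //]; rewrite /star_weight nth_default. Qed.

Lemma star_weight_ge0 c : 0 <= star_weight c.
Proof. by case: c => [//|c]; apply: le_trans (star_weight_ge1 c.+1 _). Qed.

Lemma concentrated_star_cost : exists2 x, x < 1 & concentrated (star_cost star_weight) x.
Proof.
have h1 := concentrated_degree_sum
  (fun c => star_weight c + c%:R / star_weight c) 12 5 5^-1.
have hf c : (12 <= c)%N -> star_weight c + c%:R / star_weight c = 5 + 5^-1 * c%:R.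
  by move=> hc; rewrite /star_weight nth_default // mulrC.
have h2 := concentratedD _ _ _ _ (h1 hf) (concentratedZ (- 2^-1) _ _
  (concentratedD _ _ _ _ (concentrated_degree_count 1)
     (concentratedZ (-1) _ _ concentrated_leaf_only_child_count))).
have h3 := eq_concentrated _ (star_cost star_weight) _ _ h2.
eexists; last by apply: h3 => m s _; rewrite /star_cost mulN1r mulNr.
rewrite !big_ord_recr big_ord0 /= /star_weight /= /degree_limit.
lra.
Qed.

(** * Probability of being hypoenergetic *)

Lemma BA_prob_ge0 (n : nat) (par : parent_fun n.+1) : 0 <= BA_prob par.
Proof.
case vp: (valid_parent par); last by rewrite /BA_prob vp.
by rewrite BA_prob_history // history_prob_ge0.
Qed.

Lemma sum_BA_prob (n : nat) : \sum_(par : parent_fun n.+1) BA_prob par = 1.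
Proof.
rewrite -[RHS](expect1 n) -expect_parent.
by apply: eq_bigr => par _; rewrite mulr1.
Qed.

(** The tree has [n + 1] vertices; comparing with [n] is slightly stronger and matches the event in
    [concentrated_tail]. *)
Lemma hypoenergetic_tree_star_cost (n : nat) (par : parent_fun n.+1) :
  valid_parent par -> star_cost star_weight (history_of n par) < n%:R ->
  hypoenergetic_tree par.
Proof.
move=> vp h; rewrite /hypoenergetic_tree.
apply: (le_lt_trans (tree_energy_le _ _ star_weight vp star_weight_ge0 _)).
  by move=> c c0; apply: lt_le_trans (star_weight_ge1 c c0).
rewrite -(@ratr_nat algC) ltr_rat.
have hm := history_of_mem n par vp; have [ss hs] := mem_histories _ _ hm.
apply: le_lt_trans (star_cost_ge _ _ _ ss hs star_weight_ge0 star_weight_ge1 _) _ => //.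
apply: lt_le_trans h _.
by rewrite ler_nat.
Qed.

(** A valid tree that is not hypoenergetic lies in the tail event of [star_cost], whose probability
    is [O(1 / n)]. *)
Lemma prob_hypo_bounds : exists D, forall n, (0 < n)%N ->
  1 - D / n%:R <= prob_hypo n.+1 <= 1.
Proof.
have [x x1 /concentrated_tail /(_ x1) [D hD]] := concentrated_star_cost.
exists D => n n0.
have E := sum_BA_prob n; rewrite (bigID (@hypoenergetic_tree n.+1)) /= in E.
rewrite -/(prob_hypo n.+1) in E.
have r0 : 0 <= \sum_(par | ~~ hypoenergetic_tree par) BA_prob (n := n.+1) par.
  by apply: sumr_ge0 => par _; apply: BA_prob_ge0.
have r1 : \sum_(par | ~~ hypoenergetic_tree par) BA_prob (n := n.+1) par <= D / n%:R.
  apply: le_trans (hD n n0); rewrite -expect_parent big_mkcond /=.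
  apply: ler_sum => par _; case vp: (valid_parent par); last first.
    by rewrite /BA_prob vp mul0r; case: ifP.
  case: ifP => [/negP nh|_]; last by rewrite mulr_ge0 ?BA_prob_ge0 ?ler0n.
  case: (lerP n%:R (star_cost _ _)) => [_|lt]; first by rewrite mulr1.
  by case: nh; apply: hypoenergetic_tree_star_cost.
lra.
Qed.

Theorem theorem1p1 (R : realType) :
  (fun n : nat => (ratr (prob_hypo n) : R)) @ \oo --> (1 : R).
Proof.
have [D hD] := prob_hypo_bounds.
apply/cvgrPdist_le => e e0.
pose N := Num.bound (`|ratr D : R| / e).
(* The bound concerns [n.+1] vertices with [n] positive; starting at [N.+2] makes the predecessor
   exceed [N]. *)
exists N.+2 => // -[//|n] /= Nn.
have n0 : (0 < n)%N by apply: leq_ltn_trans (leq0n N) _; rewrite -ltnS.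
have /andP[h1 h2] := hD n n0.
have nR : 0 < n%:R :> R by rewrite ltr0n.
have -> : 1 - ratr (prob_hypo n.+1) = ratr (1 - prob_hypo n.+1) :> R.
  by rewrite rmorphB rmorph1.
rewrite ger0_norm ?ler0q ?subr_ge0 //.
apply: (@le_trans _ _ (ratr (D / n%:R))); first by rewrite ler_rat; lra.
rewrite rmorphM fmorphV /= ratr_nat ler_pdivrMr //.
apply: le_trans (ler_norm _) _; rewrite -ler_pdivrMl // mulrC.
apply: ltW; apply: lt_le_trans (archi_boundP _) _; first by rewrite divr_ge0 // ltW.
by rewrite ler_nat -/N ltnW // -ltnS.
Qed.
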